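(* Let $\mathscr P=(P,G_P)$ and $\mathscr Q=(Q,G_Q)$ be causal graphical models over $\mathbf X=(X_1,\dots,X_d)$ such that $G_P$ and $G_Q$ have the same skeleton, and let $X_i\to X_j$ be an edge of $G_Q$ such that $X_j\to X_i$ is an edge of $G_P$ (a flipped edge). Let $P^e$ be an interventional distribution generated from $\mathscr P$ with target set $\mathcal I_e$. (i) If there exists an unblocked path $e\overset{G_P}{\to}X_i$ given $\mathbf{PA}_j^{G_Q}\setminus\{X_i\}$, then $P^e(X_j\mid\mathbf{PA}_j^{G_Q})\neq P(X_j\mid\mathbf{PA}_j^{G_Q})$. (ii) If there exists an unblocked path $e\overset{G_P}{\to}X_j$ given $\mathbf{PA}_i^{G_Q}$, then $P^e(X_i\mid\mathbf{PA}_i^{G_Q})\neq P(X_i\mid\mathbf{PA}_i^{G_Q})$.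
   Context: All distributions have densities with respect to Lebesgue measure; $[d]=\{1,\dots,d\}$. A causal graphical model (CGM) is a pair $(P,G)$ of a distribution over $\mathbf X$ and a DAG on $[d]$ with $P$ Markovian w.r.t. $G$ ($P(\mathbf X)=\prod_iP(X_i\mid\mathbf{PA}_i^G)$, $\mathbf{PA}_i^G$ = parents of $X_i$ in $G$). Interventional distributions: environment $e$ has target set $\mathcal I_e\subseteq[d]$ and $P^e(\mathbf X)=\prod_{i\in\mathcal I_e}\tilde P(X_i\mid\mathbf{PA}_i^{G_P})\prod_{i\notin\mathcal I_e}P(X_i\mid\mathbf{PA}_i^{G_P})$, with $P^e(X_i\mid\mathbf{PA}_i^{G_P})=P(X_i\mid\mathbf{PA}_i^{G_P})$ iff $i\notin\mathcal I_e$; mechanisms are independent causal mechanisms and pseudo causal sufficiency holds (unobserved confounders are fixed within each environment). Standing faithfulness assumption: $P$ is faithful to $G_P$, and the multi-environment distribution is faithful to the augmented DAG obtained from $G_P$ by adding an environment node $e$ with edges $e\to X_k$ for all $k\in\mathcal I_e$, so that $P^e(X\mid\mathbf Z)\ne P(X\mid\mathbf Z)$ whenever $e$ and $X$ are d-connected given $\mathbf Z$ in that augmented DAG. Unblocked path: for a DAG $G$ over $\mathbf X$ and $\mathbf Z\subseteq\mathbf X$, there is a (directed) unblocked path $e\overset{G}{\to}X_i$ given $\mathbf Z$ if there exist $k\in\mathcal I_e$ and a directed path $X_k\to\cdots\to X_i$ in $G$ none of whose vertices lies in $\mathbf Z$; if $k=i$ this condition is trivially satisfied. *)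

(* Defs.v *)
From HB Require Import structures.
From mathcomp Require Import all_boot all_order all_algebra.
From mathcomp Require Import all_classical all_reals all_analysis.
Set Implicit Arguments. Unset Strict Implicit. Unset Printing Implicit Defensive.
Import Order.TTheory GRing.Theory Num.Theory.
Local Open Scope ring_scope.

Section Graphs.
Variable T : finType.

Definition adjr (g : rel T) : rel T := fun u v => g u v || g v u.

Definition acyclic (g : rel T) : Prop := forall u v, g u v -> ~~ connect g v u.

(* d-connection of x and y given Z in the DAG g: there is a simple path
   x = w_0 - w_1 - ... - w_n = y (edges in any direction) whose endpoints are
   not in Z, such that every collider w_k (w_{k-1} -> w_k <- w_{k+1}) has a
   descendant (possibly itself) in Z, and every non-collider is not in Z. *)
Definition d_connecting_path (g : rel T) (Z : {set T}) (x y : T) (s : seq T) : bool :=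
  let w := x :: s in
  [&& uniq w, path (adjr g) x s, last x s == y, x \notin Z, y \notin Z &
      all (fun k =>
             let a := nth x w k in let b := nth x w k.+1 in let c := nth x w k.+2 in
             if g a b && g c b then [exists z, (z \in Z) && connect g b z]
             else b \notin Z)
          (iota 0 (size w - 2))].

Definition d_connected (g : rel T) (Z : {set T}) (x y : T) : Prop :=
  exists s : seq T, d_connecting_path g Z x y s.

Definition d_separated (g : rel T) (A B Z : {set T}) : Prop :=
  forall a b, a \in A -> b \in B -> ~ d_connected g Z a b.

End Graphs.

Definition pa d (G : rel 'I_d) (j : 'I_d) : {set 'I_d} := [set k | G k j].

(* augmented DAG: vertex None is the environment node e, with edges
   e -> X_k for k in the target set I; Some k is X_k. *)
Definition aug d (G : rel 'I_d) (I : {set 'I_d}) : rel (option 'I_d) :=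
  fun u v => match u, v with
             | Some a, Some b => G a b
             | None, Some b => b \in I
             | _, _ => false
             end.

Definition unblocked d (G : rel 'I_d) (I : {set 'I_d}) (Z : {set 'I_d}) (i : 'I_d) : Prop :=
  exists2 k, k \in I &
    (k = i \/ exists s : seq 'I_d,
        [&& path G k s, last k s == i & all (fun v => v \notin Z) (k :: s)]).

Section Densities.
Variables (R : realType) (d : nat).
Local Notation vec := ('I_d -> R).

Definition upd (x : vec) (k : 'I_d) (t : R) : vec :=
  fun j => if j == k then t else x j.

Definition marg1 (k : 'I_d) (f : vec -> R) : vec -> R :=
  fun x => fine (\int[@lebesgue_measure R]_t (f (upd x k t))%:E).

Definition margS (S : {set 'I_d}) (p : vec -> R) : vec -> R :=
  foldr (fun k g => marg1 k g) p (enum (~: S)).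

Definition cond (p : vec -> R) (i : 'I_d) (Z : {set 'I_d}) : vec -> R :=
  fun x => margS (i |: Z) p x / margS Z p x.

Definition cond_differs (p' p : vec -> R) (i : 'I_d) (Z : {set 'I_d}) : Prop :=
  exists x : vec, [/\ 0 < margS Z p x, 0 < margS Z p' x & cond p' i Z x != cond p i Z x].

Definition cond_indep (p : vec -> R) (A B Z : {set 'I_d}) : Prop :=
  forall x : vec, margS (A :|: B :|: Z) p x * margS Z p x
                  = margS (A :|: Z) p x * margS (B :|: Z) p x.

Definition mechanisms (G : rel 'I_d) (f : 'I_d -> vec -> R) : Prop :=
  forall i,
    [/\ forall x y : vec, (forall j, (j == i) || G j i -> x j = y j) -> f i x = f i y,
        forall x, 0 <= f i x,
        forall x, measurable_fun setT (fun t => f i (upd x i t)) &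
        forall x, (\int[@lebesgue_measure R]_t (f i (upd x i t))%:E = 1)%E].

Definition joint (f : 'I_d -> vec -> R) : vec -> R := fun x => \prod_i f i x.

Definition intervene (f g : 'I_d -> vec -> R) (I : {set 'I_d}) : 'I_d -> vec -> R :=
  fun i => if i \in I then g i else f i.

End Densities.

(* Main.v *)
Require Import Defs.
From mathcomp Require Import all_boot all_order all_algebra.
From mathcomp Require Import all_classical all_reals all_analysis.
From mathcomp Require Import zify.
Set Implicit Arguments. Unset Strict Implicit.

(* By faithfulness to the augmented DAG it suffices, in both parts, to exhibit
   a d-connecting path from the environment node e.
   (ii) The unblocked path e -> ... -> X_j, extended by X_j -> X_i, is directed
   and avoids PA_i^Q, which contains neither X_i nor X_j since G_Q is acyclic.
   (i) If the unblocked path e -> ... -> X_i passes through X_j, its prefix up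
   to X_j is directed and avoids PA_j^Q: X_i cannot occur on it, or
   X_i ->* X_j -> X_i would be a cycle of G_P.  Otherwise
   e -> ... -> X_i <- X_j has a single collider X_i, which lies in PA_j^Q, and
   all its other vertices avoid PA_j^Q.
   Directed paths and such collider paths stay d-connecting when shortened to
   simple paths. *)

Section DConnectingPaths.
Variables (T : finType) (g : rel T).
Hypothesis g_asym : forall u v, g u v -> g v u -> False.

Lemma directed_path_d_connecting (Z : {set T}) x s :
  path g x s -> uniq (x :: s) -> {in x :: s, forall v, v \notin Z} ->
  d_connecting_path g Z x (last x s) s.
Proof.
move=> gs us sZ; rewrite /d_connecting_path us eqxx.
rewrite (sub_path _ gs) => [|a b gab]; last by rewrite /adjr gab.
rewrite !sZ ?mem_head ?mem_last //=.
apply/allP => k; rewrite mem_iota add0n => /andP[_ ltk] /=.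
have ltk1 : k.+1 < size s by lia.
have gk1 : g (nth x (x :: s) k.+1) (nth x (x :: s) k.+2) by apply: (pathP x gs).
case: ifP => [/andP[_ gk2]|_]; first by case: (g_asym gk1 gk2).
by apply: sZ; rewrite inE mem_nth ?orbT // ltnW.
Qed.

Lemma collider_path_d_connecting (Z : {set T}) x s y :
  path g x s -> uniq (x :: rcons s y) -> x \notin Z -> y \notin Z ->
  last x s \in Z -> {in x :: s, forall v, v != last x s -> v \notin Z} ->
  g y (last x s) -> d_connecting_path g Z x y (rcons s y).
Proof.
move=> gs us xZ yZ bZ sZ gyb.
have us' : uniq (x :: s) by move: us; rewrite -rcons_cons rcons_uniq => /andP[].
have nth_size : nth x (x :: s) (size s) = last x s by rewrite (last_nth x) /=.
have nth_notin k : k < size s -> nth x (x :: s) k \notin Z.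
  move=> ltk; apply: sZ; first by rewrite mem_nth //= ltnW.
  by rewrite -nth_size (nth_uniq x _ _ us') //= ?ltn_eqF // ltnW.
rewrite /d_connecting_path us rcons_path /adjr gyb orbT last_rcons eqxx xZ yZ andbT /=.
rewrite (sub_path _ gs) => [|a b gab]; last by rewrite /adjr gab.
apply/allP => k; rewrite mem_iota add0n size_rcons => /andP[_ ltk] /=.
have ltks : k < size s by lia.
rewrite -rcons_cons !nth_rcons /= ltks ltnS ltnW //.
have gk : g (nth x (x :: s) k) (nth x (x :: s) k.+1) by apply: (pathP x gs).
case: (ltnP k.+1 (size s)) => [ltk1|gek1].
  have gk1 : g (nth x (x :: s) k.+1) (nth x (x :: s) k.+2) by apply: (pathP x gs).
  case: ifP => [/andP[_ gk2]|_]; first by case: (g_asym gk1 gk2).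
  exact: (nth_notin k.+1).
have ek : k.+1 = size s by apply/eqP; rewrite eqn_leq ltks.
have nth_k : nth x s k = last x s by rewrite -nth_size -ek.
rewrite -ek eqxx -[nth x s k]/(nth x (x :: s) k.+1) gk /= nth_k gyb.
by apply/existsP; exists (last x s); rewrite bZ connect0.
Qed.

Lemma d_connected_directed_path (Z : {set T}) x s :
  path g x s -> {in x :: s, forall v, v \notin Z} -> d_connected g Z x (last x s).
Proof.
move=> gs sZ; case: (shortenP gs) => s' gs' us' sub_s'.
exists s'; apply: directed_path_d_connecting => // v.
by rewrite inE => /predU1P[->|/sub_s' vs]; apply: sZ; rewrite ?mem_head // inE vs orbT.
Qed.

Lemma d_connected_collider_path (Z : {set T}) x s y :
  path g x s -> x \notin Z -> last x s \in Z ->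
  {in x :: s, forall v, v != last x s -> v \notin Z} ->
  g y (last x s) -> y \notin Z -> y \notin x :: s -> d_connected g Z x y.
Proof.
move=> gs xZ + sZ + yZ ys; case: (shortenP gs) sZ => s' gs' us' sub_s' sZ bZ gyb.
exists (rcons s' y); apply: collider_path_d_connecting => //.
  rewrite -rcons_cons rcons_uniq us' andbT; apply: contra ys.
  by rewrite !inE => /predU1P[->|/sub_s' ->]; rewrite ?eqxx ?orbT.
by move=> v; rewrite inE => /predU1P[-> //|/sub_s' vs]; apply: sZ; rewrite inE vs orbT.
Qed.

End DConnectingPaths.

Lemma path_connect_last (T : finType) (e : rel T) x s y :
  path e x s -> y \in x :: s -> connect e y (last x s).
Proof.
move=> es ys; case/splitPl: ys es => s1 s2 <-.
rewrite cat_path last_cat => /andP[_ es2].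
by apply/connectP; exists s2.
Qed.

Lemma None_notin_Some_imset (T : finType) (A : {set T}) : None \notin Some @: A.
Proof. by apply/imsetP=> -[]. Qed.

Lemma acyclic_notin_pa d (G : rel 'I_d) a b : acyclic G -> connect G a b -> b \notin pa G a.
Proof. by move=> G_acyclic Gab; rewrite inE; apply/negP=> /G_acyclic/negP. Qed.

Section AugmentedDAG.
Variables (d : nat) (G : rel 'I_d) (I : {set 'I_d}).

Lemma path_aug k s :
  k \in I -> path G k s -> path (aug G I) None (Some k :: map Some s).
Proof. by move=> kI Gs; rewrite /= kI path_map. Qed.

Lemma path_unblocked (Z : {set 'I_d}) k s :
  k \in I -> path G k s -> {in k :: s, forall v, v \notin Z} -> unblocked G I Z (last k s).
Proof. by move=> kI Gs sZ; exists k => //; right; exists s; rewrite Gs eqxx; apply/allP. Qed.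

Lemma unblocked_path (Z : {set 'I_d}) X : X \notin Z -> unblocked G I Z X ->
  exists k s, [/\ k \in I, path G k s, last k s = X & {in k :: s, forall v, v \notin Z}].
Proof.
move=> XZ [k kI [kX|[s /and3P[Gs /eqP sX /allP sZ]]]]; last by exists k, s.
by subst k; exists X, [::]; split=> // v; rewrite inE => /eqP ->.
Qed.

Lemma unblocked_step (Z : {set 'I_d}) a b :
  a \notin Z -> b \notin Z -> G a b -> unblocked G I Z a -> unblocked G I Z b.
Proof.
move=> aZ bZ Gab /(unblocked_path aZ) [k [s [kI Gs sa sZ]]].
rewrite -(last_rcons k s b); apply: path_unblocked => //; first by rewrite rcons_path Gs sa.
by move=> v; rewrite -rcons_cons mem_rcons inE => /predU1P[->|/sZ].
Qed.

Hypothesis G_acyclic : acyclic G.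

Lemma aug_asym u v : aug G I u v -> aug G I v u -> False.
Proof. by case: u v => [a|] [b|] //= Gab Gba; move: (G_acyclic Gab); rewrite connect1. Qed.

Lemma unblocked_d_connected (Z : {set 'I_d}) X : X \notin Z -> unblocked G I Z X ->
  d_connected (aug G I) (Some @: Z) None (Some X).
Proof.
move=> XZ /(unblocked_path XZ) [k [s [kI Gs <- sZ]]].
have := d_connected_directed_path aug_asym (Z := Some @: Z) (path_aug kI Gs).
rewrite /= last_map; apply=> -[u|]; last by move=> _; apply: None_notin_Some_imset.
by rewrite inE /= -map_cons mem_map // => /sZ; rewrite mem_imset.
Qed.

Lemma unblocked_collider_d_connected (Z : {set 'I_d}) i j :
  G j i -> i \notin Z -> j \notin Z -> unblocked G I Z i ->
  d_connected (aug G I) (Some @: (i |: Z)) None (Some j).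
Proof.
move=> Gji iZ jZ /(unblocked_path iZ) [k [s [kI Gs si sZ]]].
have ji : j != i by apply: contraNneq (G_acyclic Gji) => ->; apply: connect0.
have jiZ : j \notin i |: Z by rewrite !inE negb_or ji.
have [js|jns] := boolP (j \in k :: s).
  case/splitPl: js Gs sZ => s1 s2 s1j; rewrite cat_path => /andP[Gs1 _] sZ.
  have is1 : i \notin k :: s1.
    by apply/negP=> /(path_connect_last Gs1); rewrite s1j; apply/negP/G_acyclic.
  apply: unblocked_d_connected => //; rewrite -s1j; apply: path_unblocked => // v vs1.
  by rewrite !inE negb_or (memPn is1) //= sZ // -cat_cons mem_cat vs1.
have last_aug : last None (Some k :: map Some s) = Some i by rewrite /= last_map si.
apply: (d_connected_collider_path aug_asym (path_aug kI Gs)); rewrite ?last_aug //=.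
- exact: None_notin_Some_imset.
- by rewrite mem_imset // setU11.
- move=> [u|_ _]; last exact: None_notin_Some_imset.
  rewrite inE /= -map_cons mem_map // => us; rewrite (inj_eq Some_inj) => ui.
  by rewrite mem_imset // !inE negb_or ui sZ.
- by rewrite mem_imset.
- by rewrite inE /= -map_cons mem_map.
Qed.

End AugmentedDAG.

Theorem lemma18 (R : realType) (d : nat)
  (GP GQ : rel 'I_d) (fP fQ : 'I_d -> ('I_d -> R) -> R)
  (I : {set 'I_d}) (g : 'I_d -> ('I_d -> R) -> R) (i j : 'I_d) :
  (* (P, G_P) and (Q, G_Q) are causal graphical models *)
  acyclic GP -> acyclic GQ ->
  mechanisms GP fP -> mechanisms GQ fQ ->
  (* same skeleton *)
  (forall a b, adjr GP a b = adjr GQ a b) ->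
  (* flipped edge: X_i -> X_j in G_Q, X_j -> X_i in G_P *)
  GQ i j -> GP j i ->
  (* P^e generated from (P, G_P) with target set I *)
  mechanisms GP g ->
  (forall k, k \in I ->
     cond_differs (joint (intervene fP g I)) (joint fP) k (pa GP k)) ->
  (* faithfulness of P to G_P *)
  (forall A B Z : {set 'I_d}, [disjoint A & B] -> [disjoint A & Z] -> [disjoint B & Z] ->
     cond_indep (joint fP) A B Z -> d_separated GP A B Z) ->
  (* faithfulness to the augmented DAG *)
  (forall (X : 'I_d) (Z : {set 'I_d}), X \notin Z ->
     d_connected (aug GP I) (Some @: Z) None (Some X) ->
     cond_differs (joint (intervene fP g I)) (joint fP) X Z) ->
  (unblocked GP I (pa GQ j :\ i) i ->
     cond_differs (joint (intervene fP g I)) (joint fP) j (pa GQ j)) /\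
  (unblocked GP I (pa GQ i) j ->
     cond_differs (joint (intervene fP g I)) (joint fP) i (pa GQ i)).
Proof.
move=> GP_acyclic GQ_acyclic _ _ _ GQij GPji _ _ _ faithful_aug.
have notin_pa a b : connect GQ a b -> b \notin pa GQ a := acyclic_notin_pa GQ_acyclic.
have jj := notin_pa j j (connect0 _ _); have ii := notin_pa i i (connect0 _ _).
split=> [e_to_i | e_to_j].
- apply: (faithful_aug _ _ jj).
  have ij : i \in pa GQ j by rewrite inE.
  rewrite -(finset.setD1K ij); apply: unblocked_collider_d_connected => //.
    by rewrite setD11.
  by rewrite in_setD1 (negbTE jj) andbF.
- apply: (faithful_aug _ _ ii (unblocked_d_connected GP_acyclic ii _)).
  exact: unblocked_step (notin_pa i j (connect1 GQij)) ii GPji e_to_j.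
Qed.
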